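(* Let $\phi\in\Phi$ (with $\lambda_0=\infty$), put $\beta_\phi(y)=\phi(e^y)$ for $y\in\mathbb R$, and suppose that the function $\Delta_\phi=\beta_\phi^*$ (on $(0,\infty)$) satisfies condition $(\Delta)$ stated in the context. Let $\psi_\phi(p)=p\exp[-\beta_\phi^*(p)/p]$ for $p\ge1$. Then the norms $\|\cdot\|B(\phi)$ and $\|\cdot\|G\psi_\phi$ are equivalent: there are constants $C,C'\in(0,\infty)$, depending only on $\phi$, such that for every centered random variable $\xi$ $$\|\xi\|B(\phi)\le C\,\|\xi\|G\psi_\phi\le C'\,\|\xi\|B(\phi).$$
   Context: Centered means $\mathbf E\xi=0$. $\beta_\phi^*(p)=\sup_{y\in\mathbb R}(py-\beta_\phi(y))$. $|\xi|_p=(\mathbf E|\xi|^p)^{1/p}$, and for a positive function $\psi$ on $[1,\infty)$, $\|\xi\|G\psi=\sup_{p\ge1}|\xi|_p/\psi(p)\in[0,\infty]$. $\Phi$ (with $\lambda_0=\infty$) is the set of even, strictly convex, twice continuously differentiable functions $\phi:\mathbb R\to\mathbb R$, positive for positive arguments, with $\phi(0)=\phi'(0)=0$, $\phi''(0)>0$, $\lim_{\lambda\to\infty}\phi(\lambda)/\lambda=\infty$. For $\phi\in\Phi$ and centered $\xi$, $\|\xi\|B(\phi)=\inf\{\tau>0:\ \max_{\pm}\mathbf E\exp(\pm\lambda\xi)\le\exp(\phi(\lambda\tau))\ \forall\lambda\in\mathbb R\}\in[0,\infty]$. For $\Delta:(0,\infty)\to\mathbb R$ put $\Delta^*(\mu)=\sup_{p>0}(p\mu-\Delta(p))$,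 $\sigma(\epsilon)=\sum_{k=2,4,6,\ldots}e^{\Delta(\epsilon k)-\Delta(k)}$ for $\epsilon\in(0,1)$, and $\Delta_1^*(\mu)=\inf_{\epsilon\in(0,1)}\ln\bigl\{\sigma(\epsilon)\exp(\Delta^*(\mu/\epsilon))\bigr\}$. Condition $(\Delta)$: there is a constant $C_4\in[1,\infty)$ such that $\Delta_1^*(\ln|\lambda|)\le\Delta^*(\ln|C_4\lambda|)$ for all $\lambda\in\mathbb R\setminus\{0\}$. *)

(* Defs.v *)
From HB Require Import structures.
From mathcomp Require Import all_boot all_order all_algebra.
From mathcomp Require Import all_classical all_reals all_analysis.

Set Implicit Arguments.
Unset Strict Implicit.
Unset Printing Implicit Defensive.

Import Order.TTheory GRing.Theory Num.Theory.
Import numFieldNormedType.Exports.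

Local Open Scope classical_set_scope.
Local Open Scope ring_scope.

Definition strictly_convex (R : realType) (f : R -> R) : Prop :=
  forall x y t : R, x != y -> 0 < t < 1 ->
    f (t * x + (1 - t) * y) < t * f x + (1 - t) * f y.

Record Phi (R : realType) (phi : R -> R) : Prop := {
  Phi_even : forall x, phi (- x) = phi x;
  Phi_convex : strictly_convex phi;
  Phi_diff1 : forall x, derivable phi x 1;
  Phi_diff2 : forall x, derivable (derive1 phi) x 1;
  Phi_cont2 : continuous (derive1n 2 phi);
  Phi_pos : forall x, 0 < x -> 0 < phi x;
  Phi_0 : phi 0 = 0;
  Phi_d1_0 : derive1 phi 0 = 0;
  Phi_d2_0 : 0 < derive1n 2 phi 0;
  Phi_superlinear : phi x / x @[x --> +oo] --> +oo
}.

(* Young-Fenchel transform, the supremum being taken over the domain D. *)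
Definition fenchel (R : realType) (D : set R) (f : R -> R) (x : R) : \bar R :=
  ereal_sup [set (x * y - f y)%:E | y in D].

Definition beta (R : realType) (phi : R -> R) (y : R) : R := phi (expR y).

(* [fine] discards no information: see [fenchel_beta_fin_num]. *)
Definition Delta_phi (R : realType) (phi : R -> R) (p : R) : R :=
  fine (fenchel setT (beta phi) p).

Definition psi_phi (R : realType) (phi : R -> R) (p : R) : R :=
  p * expR (- (Delta_phi phi p / p)).

(* Functions Delta on (0, +oo) are represented by total functions R -> R; the
   definitions below only use the values at positive arguments. *)
Section condition_Delta.
Variables (R : realType) (Delta : R -> R).
Local Open Scope ereal_scope.

Definition Delta_star (mu : R) : \bar R := fenchel [set p | (0 < p)%R] Delta mu.

Definition sigma (eps : R) : \bar R :=
  \sum_(2 <= k <oo | ~~ odd k) (expR (Delta (eps * k%:R) - Delta k%:R)%R)%:E.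

Definition Delta1_star (mu : R) : \bar R :=
  ereal_inf [set lne (sigma eps * expeR (Delta_star (mu / eps)%R))
            | eps in [set eps | (0 < eps < 1)%R]].

Definition cond_Delta : Prop :=
  exists2 C4 : R, (1 <= C4)%R &
    forall lambda : R, lambda != 0%R ->
      Delta1_star (ln `|lambda|)%R <= Delta_star (ln `|C4 * lambda|)%R.

End condition_Delta.

Section norms.
Context d (T : measurableType d) (R : realType) (P : probability T R).
Local Open Scope ereal_scope.

Definition centered (X : {RV P >-> R}) : Prop :=
  P.-integrable setT (EFin \o X) /\ 'E_P[X] = 0.

(* mmt_gen_fun P X l is the expectation of exp(l X), possibly +oo. *)
Definition Bnorm (phi : R -> R) (X : {RV P >-> R}) : \bar R :=
  ereal_inf [set tau%:E | tau in [set tau : R | (0 < tau)%R /\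
    forall l : R, maxe (mmt_gen_fun P X l) (mmt_gen_fun P X (- l)%R)
                  <= (expR (phi (l * tau)%R))%:E]].

Definition Gnorm (psi : R -> R) (X : {RV P >-> R}) : \bar R :=
  ereal_sup [set 'N[P]_(p%:E)[EFin \o X] / (psi p)%:E
            | p in [set p | (1 <= p)%R]].

End norms.

Lemma fenchel_beta_fin_num (R : realType) (phi : R -> R) (p : R) :
  Phi phi -> 0 < p -> fenchel setT (beta phi) p \is a fin_num.
Proof.
move=> Hphi p0; have /cvgryPge/(_ p)[M [_ HM]] := Phi_superlinear Hphi.
set M' := Num.max 1 (M + 1).
have M'0 : 0 < M' by rewrite lt_max ltr01.
rewrite fin_numE -ltNye -ltey; apply/andP; split.
  apply: (@lt_le_trans _ _ (p * 0 - beta phi 0)%:E); first exact: ltNyr.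
  by apply: ereal_sup_ubound; exists 0.
apply: (@le_lt_trans _ _ (Num.max 0 (p * ln M'))%:E); last exact: ltry.
apply: ge_ereal_sup => _ [y _ <-]; rewrite lee_fin /beta le_max.
have ey := expR_gt0 y.
have [lt_y|le_y] := ltP (expR y) M'.
  apply/orP; right; rewrite lerBlDr.
  apply: (@le_trans _ _ (p * ln M')); last by rewrite lerDl ltW// (Phi_pos Hphi).
  by rewrite ler_pM2l// -[y]expRK ler_ln// ?posrE// ltW.
apply/orP; left; rewrite subr_le0.
have /HM : M < expR y.
  by apply: lt_le_trans le_y; rewrite lt_max ltrDl ltr01 orbT.
rewrite /= ler_pdivlMr// => /(le_trans _); apply.
by rewrite ler_pM2l// (le_trans _ (expR_ge1Dx y))// lerDr.
Qed.

(* Main.v *)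
Require Import Defs.
From HB Require Import structures.
From mathcomp Require Import all_boot all_order all_algebra.
From mathcomp Require Import all_classical all_reals all_analysis.
From mathcomp Require Import measurable_realfun ring lra.
Set Implicit Arguments.
Unset Strict Implicit.
Unset Printing Implicit Defensive.
Import Order.TTheory GRing.Theory Num.Theory.
Import numFieldNormedType.Exports.
Local Open Scope classical_set_scope.
Local Open Scope ring_scope.

(* Write D for Delta_phi. From mgf to moments: t <= e^t gives
   E|X|^p <= (p/l)^p (E e^{lX} + E e^{-lX}) <= 2 (p/l)^p e^{phi(l tau)}, and with
   l = e^y / tau the exponent is phi(e^y) - p y, which is nearly -D(p) for a
   nearly optimal y.
   From moments to mgf: for centered X, e^y <= 1 + y + (e^y + e^{-y} - 2) bounds
   E e^{lX} by an even power series. With E|X|^k <= (a psi(k))^k and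
   k^k / k! <= e^k it is at most 1 + 2 F(x), where x = e a |l| and
   F(x) = sum_{k = 2, 4, ...} x^k e^{-D(k)}. Splitting
   x^k e^{-D(k)} = e^{k ln x - D(eps k)} e^{D(eps k) - D(k)} yields
   ln F(x) <= D_1^*(ln x), hence condition (Delta) and the trivial half of
   Fenchel duality, D^* <= beta_phi, give F(x) <= e^{phi(C x)}. *)

(** * Growth of a function of the class [Phi] *)

Section young_function.
Context (R : realType) (phi : R -> R).
Hypothesis hphi : Phi phi.

Lemma Phi_ge0 x : 0 <= x -> 0 <= phi x.
Proof.
by rewrite le_eqVlt => /predU1P[<-|/(Phi_pos hphi)/ltW//]; rewrite (Phi_0 hphi).
Qed.

Lemma Phi_abs x : phi `|x| = phi x.
Proof. by case: (ger0P x) => // _; rewrite (Phi_even hphi). Qed.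

(** Convexity between [0] and [K * x], with weight [K^-1] at [K * x], combined with [phi 0 = 0].
    With [K] a ratio of arguments it later also yields monotonicity. *)
Lemma Phi_scale_ge K x : 1 <= K -> 0 <= x -> K * phi x <= phi (K * x).
Proof.
rewrite le_eqVlt => /predU1P[<-|K1]; first by rewrite !mul1r.
rewrite le_eqVlt => /predU1P[<-|x0]; first by rewrite mulr0 (Phi_0 hphi) mulr0.
have K0 : 0 < K by rewrite (lt_trans _ K1).
have Kx0 : K * x != 0 by rewrite mulf_neq0 ?gt_eqF.
have t01 : 0 < K^-1 < 1 by rewrite invr_gt0 K0 invf_lt1.
have := Phi_convex hphi Kx0 t01.
rewrite mulrA mulVf ?gt_eqF// mul1r mulr0 addr0 (Phi_0 hphi) mulr0 addr0.
by rewrite ltr_pdivlMl// => /ltW.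
Qed.

(* The mean value theorem on [y / 2, y] turns [phi' y >= m y] near 0 into a
   quadratic lower bound for [phi]; convexity carries it over to [0, 1]. *)
Lemma Phi_ge_sqr : exists2 c, 0 < c & forall y, 0 <= y <= 1 -> c * y ^+ 2 <= phi y.
Proof.
pose D := 'D_1 (derive1 phi) 0.
pose m := D / 2.
have m0 : 0 < m by rewrite divr_gt0// /D -derive1E; exact: (Phi_d2_0 hphi).
have [e /= e0 dphi_ge] : exists2 e : R, 0 < e &
    forall y, 0 < y < e -> m * y <= derive1 phi y.
  have : h^-1 *: ((derive1 phi \o shift 0) (h *: 1) - derive1 phi 0)
      @[h --> 0^'] --> D by exact: (@Phi_diff2 _ _ hphi 0).
  move=> /cvgrPdist_lt /(_ m m0) [e /= e0 He]; exists e => // y /andP[y0 ye].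
  (* Since the derivative vanishes at [0], the difference quotient is [derive1 phi y / y]; being
     within [m] of [D], which is twice [m], it is at least [m]. *)
  have := He y; rewrite /ball/= sub0r normrN gtr0_norm// => /(_ ye).
  rewrite gt_eqF// [y *: 1]mulr1 /= addr0 (Phi_d1_0 hphi) subr0 => /(_ isT).
  rewrite /GRing.scale/= ltr_distl -ltrBlDr => /andP[_].
  rewrite (_ : D - m = m); last by rewrite /m; lra.
  by rewrite mulrC ltr_pdivlMr// => /ltW.
pose x0 := Num.min 1 (e / 2).
have x00 : 0 < x0 by rewrite lt_min ltr01 divr_gt0.
have x0e : x0 < e by rewrite gt_min; apply/orP; right; lra.
have x01 : x0 <= 1 by rewrite ge_min lexx.
have near0 y : 0 < y <= x0 -> m / 4 * y ^+ 2 <= phi y.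
  move=> /andP[y0 yx0].
  have y2y : y / 2 < y by lra.
  have [||c /=] := @MVT _ phi (derive1 phi) _ _ y2y.
  - move=> x _; rewrite derive1E; apply: derivableP; exact: (Phi_diff1 hphi).
  - by apply: derivable_within_continuous => x _; exact: (Phi_diff1 hphi).
  rewrite in_itv/= => /andP[yc cy] phiE.
  have c0 : 0 < c < e by apply/andP; split; lra.
  have := dphi_ge _ c0 => phic.
  have h2 : 0 <= phi (y / 2) by apply: Phi_ge0; lra.
  have h3 : m * (y / 2) <= derive1 phi c by rewrite (le_trans _ phic)// ler_pM2l// ltW.
  have : m * (y / 2) * (y - y / 2) <= derive1 phi c * (y - y / 2).
    by rewrite ler_wpM2r//; lra.
  rewrite -phiE (_ : m * (y / 2) * (y - y / 2) = m / 4 * y ^+ 2); first by lra.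
  by field.
(* On [[0, x0]] the extra factor [x0 <= 1] only weakens [near0]. Beyond [x0], scaling from [x0]
   gives the linear bound [m / 4 * x0 * y], which dominates the quadratic one because [y <= 1]. *)
exists (m / 4 * x0); first by rewrite mulr_gt0//; lra.
move=> y /andP[y0 y1]; have [yx0|x0y] := leP y x0.
  move: y0; rewrite le_eqVlt => /predU1P[<-|y0].
    by rewrite expr0n mulr0 (Phi_0 hphi).
  apply: le_trans (near0 y _); last by rewrite y0.
  by rewrite ler_wpM2r ?sqr_ge0// ler_piMr//; lra.
have K1 : 1 <= y / x0 by rewrite ler_pdivlMr// mul1r ltW.
have := Phi_scale_ge K1 (ltW x00).
rewrite divfK ?gt_eqF//; apply: le_trans.
apply: (@le_trans _ _ (y / x0 * (m / 4 * x0 ^+ 2))); last first.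
  by rewrite ler_wpM2l ?divr_ge0// ?(ltW x00)// near0// x00 lexx.
rewrite (_ : y / x0 * _ = m / 4 * x0 * y); last by field; rewrite gt_eqF.
have c0 : 0 <= m / 4 * x0 by rewrite mulr_ge0//; lra.
by rewrite ler_wpM2l// expr2 ler_piMl.
Qed.

End young_function.

(** * Bounding the exponential by an even power series *)

Lemma expR_le_cosh (R : realType) (y : R) :
  expR y <= 1 + y + (expR y + expR (- y) - 2).
Proof. have := expR_ge1Dx (- y); lra. Qed.

(** In the partial sums at [y] and [- y] the odd terms cancel, the even ones double, and the [2]
    removes the terms of index 0. The limit is taken on the left only, once the right side is known
    to be finite. *)
Lemma cosh_le_series (R : realType) (y : R) :
  ((expR y + expR (- y) - 2)%:E <=
   2%:E * \sum_(2 <= k <oo | ~~ odd k) (y ^+ k / k`!%:R)%:E)%E.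
Proof.
set S := (\sum_(2 <= k <oo | _) _)%E.
have part_le n : ((series (exp_coeff y) n + series (exp_coeff (- y)) n - 2)%:E <=
    2%:E * S)%E.
  have t0 k : (2 <= k)%N -> ~~ odd k -> (0 <= (y ^+ k / k`!%:R)%:E)%E.
    by move=> _ ek; rewrite lee_fin divr_ge0// exprn_even_ge0.
  apply: (@le_trans _ _ (2%:E * \sum_(2 <= k < n | ~~ odd k) (y ^+ k / k`!%:R)%:E)%E);
    last by rewrite lee_pmul2l// nneseries_lim_ge.
  rewrite sumEFin -EFinM lee_fin /series/=.
  (* The terms of index 0 and 1 are split off below, so [n = 0] and [n = 1] stand apart; there the
     left side is [- 2] or [0]. *)
  case: n => [|[|n]].
  - by rewrite !big_geq//; lra.
  - by rewrite !big_nat1 big_geq// /exp_coeff/= !expr0 fact0; lra.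
  have seriesE z : \sum_(0 <= k < n.+2) exp_coeff z k =
      1 + z + \sum_(2 <= k < n.+2) exp_coeff z k.
    by rewrite 2?big_ltn// /exp_coeff/= expr0 expr1 fact0 divr1 divr1 addrA.
  rewrite !seriesE (_ : forall a b : R, 1 + y + a + (1 - y + b) - 2 = a + b);
    last by move=> a b; lra.
  rewrite -big_split/= mulr_sumr [leRHS]big_mkcond/= le_eqVlt; apply/orP; left.
  apply/eqP/eq_bigr => k _; rewrite /exp_coeff/= exprNn -signr_odd; case: odd => /=; lra.
case: (leP +oo%E (2%:E * S)%E) => [/(le_trans _)->//|]; first by rewrite leey.
have S0 : (0 <= 2%:E * S)%E.
  apply: mule_ge0 => //; apply: nneseries_ge0 => k _ ek.
  by rewrite lee_fin divr_ge0// exprn_even_ge0.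
move=> Sy; rewrite -(fineK (_ : (2%:E * S)%E \is a fin_num)) ?ge0_fin_numE//.
have Sf : (2%:E * S)%E \is a fin_num by rewrite ge0_fin_numE.
rewrite lee_fin lerBlDr /expR -limD; try exact: is_cvg_series_exp_coeff.
apply: limr_le; first by apply: is_cvgD; exact: is_cvg_series_exp_coeff.
apply: nearW => n; have := part_le n.
by rewrite -(fineK Sf) lee_fin lerBlDr.
Qed.

(** * Fenchel duality and condition (Delta) *)

Lemma fenchel_young (R : realType) (phi : R -> R) (p y : R) :
  Phi phi -> 0 < p -> p * y - beta phi y <= Delta_phi phi p.
Proof.
move=> hphi p0; rewrite -lee_fin /Delta_phi fineK ?fenchel_beta_fin_num//.
by apply: ereal_sup_ubound; exists y.
Qed.

Lemma Delta_star_le (R : realType) (phi : R -> R) (mu : R) :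
  Phi phi -> (Delta_star (Delta_phi phi) mu <= (beta phi mu)%:E)%E.
Proof.
move=> hphi; apply: ge_ereal_sup => _ [p /= p0 <-].
by rewrite lee_fin; have := fenchel_young mu hphi p0; lra.
Qed.

(** The series F of the opening comment, for a general [Delta]. Extended real values allow it to be
    bounded before its convergence is known. *)
Definition even_series (R : realType) (Delta : R -> R) (x : R) : \bar R :=
  (\sum_(2 <= k <oo | ~~ odd k) (x ^+ k * expR (- Delta k%:R))%:E)%E.

Lemma even_series_ge0 (R : realType) (Delta : R -> R) (x : R) :
  (0 <= even_series Delta x)%E.
Proof.
apply: nneseries_ge0 => k _ ek; rewrite lee_fin mulr_ge0 ?expR_ge0//.
exact: exprn_even_ge0.
Qed.

Lemma even_series_le_sigma (R : realType) (Delta : R -> R) (x eps : R) :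
  0 < x -> 0 < eps < 1 ->
  Delta_star Delta (ln x / eps) \is a fin_num ->
  (even_series Delta x <=
   sigma Delta eps * expeR (Delta_star Delta (ln x / eps)))%E.
Proof.
move=> x0 /andP[e0 e1] Df; rewrite -(fineK Df) /= muleC.
rewrite /sigma -nneseriesZl; last by move=> k _; rewrite lee_fin expR_ge0.
rewrite /even_series eseries_cond [leRHS]eseries_cond.
apply: lee_nneseries => [k _ /andP[ek _]|k /andP[ek k2]].
  by rewrite lee_fin mulr_ge0 ?expR_ge0// exprn_even_ge0.
rewrite -EFinM lee_fin -expRD -{1}(lnK x0) -expRM_natl -expRD ler_expR.
(* The supremum in the conjugate at [ln x / eps] is tested at the point [eps * k], where its linear
   part is [k * ln x]. *)
have k0 : 0 < eps * k%:R by rewrite mulr_gt0// ltr0n (ltn_trans _ k2).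
have : ((ln x / eps * (eps * k%:R) - Delta (eps * k%:R))%:E
    <= Delta_star Delta (ln x / eps))%E.
  by apply: ereal_sup_ubound; exists (eps * k%:R).
rewrite -(fineK Df) lee_fin mulrA divfK ?gt_eqF//.
by lra.
Qed.

Lemma even_series_le (R : realType) (phi : R -> R) :
  Phi phi -> cond_Delta (Delta_phi phi) -> exists2 C, 1 <= C &
  forall x, 0 < x -> (even_series (Delta_phi phi) x <= (expR (phi (C * x)))%:E)%E.
Proof.
move=> hphi [C C1 hC]; exists C => // x x0.
set S := even_series _ x; have S0 : (0 <= S)%E by exact: even_series_ge0.
have Cx0 : 0 < C * x by rewrite mulr_gt0// (lt_le_trans _ C1).
(* Bounded above by [beta phi mu], and below by the value at [p = 1]. *)
have star_fin mu : Delta_star (Delta_phi phi) mu \is a fin_num.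
  rewrite fin_numE -ltNye -ltey (le_lt_trans (Delta_star_le _ hphi)) ?ltry//.
  rewrite andbT (@lt_le_trans _ _ (mu * 1 - Delta_phi phi 1)%:E) ?ltNyr//.
  by apply: ereal_sup_ubound; exists 1 => //=.
(* [expeR (lne S) = S] holds on all of [[0, +oo]], so the comparison passes to logarithms although
   [S] is not yet known to be finite. *)
rewrite -(eqP (_ : expeR (lne S) == S)); last by rewrite lneK_eq.
rewrite -[leRHS]/(expeR (phi (C * x))%:E) lee_expeR.
apply: (@le_trans _ _ (Delta1_star (Delta_phi phi) (ln x))).
  apply: le_ereal_inf_tmp => _ [eps /= e01 <-].
  have := even_series_le_sigma x0 e01 (star_fin _).
  rewrite -/S => Sle; rewrite lee_lne ?in_itv/= ?leey ?andbT//.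
  exact: le_trans S0 Sle.
have := hC x; rewrite gt_eqF// => /(_ isT); rewrite !gtr0_norm//.
move=> /le_trans; apply.
by apply: le_trans (Delta_star_le _ hphi) _; rewrite /beta lnK.
Qed.

Lemma even_series_le_sqr (R : realType) (Delta : R -> R) (x : R) :
  0 <= x <= 1 ->
  (even_series Delta x <= (x ^+ 2)%:E * even_series Delta 1)%E.
Proof.
move=> /andP[x0 x1]; rewrite /even_series -nneseriesZl; last first.
  by move=> k _; rewrite lee_fin expr1n mul1r expR_ge0.
rewrite eseries_cond [leRHS]eseries_cond.
apply: lee_nneseries => [k _ _|k /andP[ek k2]].
  by rewrite lee_fin mulr_ge0 ?exprn_ge0 ?expR_ge0.
rewrite -EFinM lee_fin expr1n mul1r ler_wpM2r ?expR_ge0//.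
exact: ler_wiXn2l.
Qed.

(* The constant K serves two regimes. For [x >= 1] the factor 3 <= e^2 is
   absorbed by [phi (K x) >= K phi x]; for [x <= 1] the series is O(x^2), which
   is absorbed by the quadratic lower bound for [phi]. *)
Lemma even_series_expR_phi (R : realType) (phi : R -> R) :
  Phi phi -> cond_Delta (Delta_phi phi) -> exists2 K, 0 < K &
  forall x, 0 < x ->
    (1 + 2%:E * even_series (Delta_phi phi) x <= (expR (phi (K * x)))%:E)%E.
Proof.
move=> hphi hD; have [C C1 hC] := even_series_le hphi hD.
have [c c0 hc] := Phi_ge_sqr hphi.
have C0 : 0 < C by rewrite (lt_le_trans _ C1).
have phiC0 := Phi_pos hphi C0.
(* [A] ensures [A * phi (C * x) >= 2 + phi (C * x)] once [phi (C * x) >= phi C]; [B] ensures [B * (c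
   * x ^+ 2) = c * x ^+ 2 + 2 * (x ^+ 2 * expR (phi C))]. *)
pose A := 1 + 2 / phi C; pose B := 1 + 2 * expR (phi C) / c.
have A1 : 1 <= A by rewrite lerDl divr_ge0// ltW.
have B1 : 1 <= B by rewrite lerDl divr_ge0// ?mulr_ge0 ?expR_ge0// ltW.
have AB : 0 < A * C * B by rewrite !mulr_gt0 ?(lt_le_trans ltr01).
have phi_homo x y : 0 < x -> x <= y -> phi x <= phi y.
  move=> x0 xy; have x1 : 1 <= y / x by rewrite ler_pdivlMr// mul1r.
  have := Phi_scale_ge hphi x1 (ltW x0); rewrite divfK ?gt_eqF//.
  by apply: le_trans; rewrite ler_peMl// (Phi_ge0 hphi)// ltW.
exists (A * C * B) => // x x0; have [x1|x1] := leP 1 x.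
  have Cx0 : 0 < C * x by rewrite mulr_gt0.
  apply: (@le_trans _ _ (expR (phi (A * (C * x))))%:E); last first.
    rewrite lee_fin ler_expR; apply: phi_homo; rewrite ?mulr_gt0 ?(lt_le_trans _ A1)//.
    by rewrite mulrA -[leRHS]mulrA (mulrC B) mulrA ler_peMr// ltW// !mulr_gt0// (lt_le_trans _ A1).
  apply: (@le_trans _ _ (1 + 2 * expR (phi (C * x)))%:E).
    by rewrite [leRHS]EFinD [in leRHS]EFinM leeD2l// lee_pmul2l// hC.
  apply: (@le_trans _ _ (expR (2 + phi (C * x)))%:E).
    rewrite lee_fin expRD.
    have e1 : 1 <= expR (phi (C * x)) by rewrite -expR0 ler_expR (Phi_ge0 hphi)// ltW.
    have := expR_ge1Dx (2 : R); nra.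
  rewrite lee_fin ler_expR; apply: le_trans (Phi_scale_ge hphi A1 (ltW Cx0)).
  have : phi C <= phi (C * x) by apply: phi_homo => //; rewrite ler_peMr// ltW.
  rewrite /A mulrDl mul1r addrC lerD2l -mulrA => h.
  by rewrite -[leLHS]mulr1 ler_pM2l// mulrC ler_pdivlMr// mul1r.
have x01 : 0 <= x <= 1 by rewrite !ltW.
apply: (@le_trans _ _ (expR (phi (B * x)))%:E); last first.
  rewrite lee_fin ler_expR; apply: phi_homo; rewrite ?mulr_gt0 ?(lt_le_trans _ B1)//.
  by rewrite ler_pM2r// ler_peMl ?(le_trans _ B1)// (le_trans A1)// ler_peMr// (le_trans _ A1).
(* The factor [expR (phi C)] bounds the series at [1]. *)
apply: (@le_trans _ _ (1 + 2 * (x ^+ 2 * expR (phi C)))%:E).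
  rewrite [leRHS]EFinD [in leRHS]EFinM leeD2l// lee_pmul2l//.
  rewrite (le_trans (even_series_le_sqr _ x01))//.
  by rewrite [leRHS]EFinM lee_wpmul2l ?lee_fin ?sqr_ge0// -[C in leRHS]mulr1 hC.
rewrite lee_fin (le_trans (expR_ge1Dx _))// ler_expR.
apply: le_trans (Phi_scale_ge hphi B1 (ltW x0)).
apply: (@le_trans _ _ (B * (c * x ^+ 2))); last by rewrite ler_wpM2l ?(le_trans _ B1)// hc.
rewrite (_ : B * _ = c * x ^+ 2 + 2 * (x ^+ 2 * expR (phi C))); last first.
  by rewrite /B; field; rewrite gt_eqF.
by rewrite lerDr mulr_ge0 ?sqr_ge0// ltW.
Qed.

(** * Moments against exponential moments *)

Lemma powR_norm_le_expR (R : realType) (x p l : R) : 0 < p -> 0 < l ->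
  `|x| `^ p <= (p / l) `^ p * (expR (l * x) + expR (- l * x)).
Proof.
move=> p0 l0; apply: (@le_trans _ _ ((p / l) `^ p * expR (l * `|x|))).
  rewrite -(divfK (lt0r_neq0 p0) (l * `|x|)) expRM -powRM ?expR_ge0//; last first.
    by rewrite divr_ge0 ?(ltW l0) ?(ltW p0).
  apply: ge0_ler_powR; rewrite ?nnegrE ?(ltW p0) ?normr_ge0//.
    by rewrite mulr_ge0 ?expR_ge0// divr_ge0 ?(ltW l0) ?(ltW p0).
  (* With the power [p] removed, what remains is [t <= expR t] at [t = l * |x| / p]. *)
  rewrite -ler_pdivrMl ?divr_gt0// invf_div mulrAC.
  by apply: le_trans (expR_ge1Dx _); rewrite lerDr.
rewrite ler_wpM2l ?powR_ge0//; case: (ger0P x) => _.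
  by rewrite lerDl expR_ge0.
by rewrite mulrN -mulNr lerDr expR_ge0.
Qed.

Section integral_series.
Local Open Scope ereal_scope.
Context d (T : measurableType d) (R : realType) (mu : {measure set T -> \bar R}).
Variables (N : nat) (Q : pred nat) (f : nat -> T -> \bar R).
Hypothesis mf : forall k, measurable_fun [set: T] (f k).
Hypothesis f0 : forall k w, Q k -> 0 <= f k w.

(** Extension by zero turns the restricted sum into one over all indices with terms that are
    nonnegative everywhere, the form to which monotone convergence applies. *)
Let g k w := if Q k && (N <= k)%N then f k w else 0.

Let seriesE (u : nat -> \bar R) : \sum_(N <= k <oo | Q k) u k =
  \sum_(0 <= k <oo) (if Q k && (N <= k)%N then u k else 0).
Proof. by rewrite eseries_cond eseries_mkcond. Qed.

Let g0 k w : 0 <= g k w.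
Proof. by rewrite /g; case: ifP => // /andP[/f0]. Qed.

Let mg k : measurable_fun [set: T] (g k).
Proof. by rewrite /g; case: (Q k && _) => //; exact: measurable_cst. Qed.

Lemma measurable_fun_nneseries :
  measurable_fun [set: T] (fun w => \sum_(N <= k <oo | Q k) f k w).
Proof.
under eq_fun do rewrite seriesE.
apply: (@ge0_emeasurable_sum _ _ _ _ g xpredT) => [k w _ _|k _]; [exact: g0|exact: mg].
Qed.

Lemma integral_nneseries_cond :
  \int[mu]_w (\sum_(N <= k <oo | Q k) f k w) =
  \sum_(N <= k <oo | Q k) \int[mu]_w f k w.
Proof.
rewrite seriesE; under eq_integral do rewrite seriesE.
rewrite (@integral_nneseries _ _ _ mu _ measurableT g)//.
congr (limn _); apply/funext => n; apply: eq_bigr => k _.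
by rewrite /g; case: (Q k && _) => //; exact: integral0.
Qed.

End integral_series.

Section moments.
Local Open Scope ereal_scope.
Context d (T : measurableType d) (R : realType) (P : probability T R).
Variable X : {RV P >-> R}.

Lemma measurable_fun_comp_RV (h : R -> R) :
  measurable_fun [set: R] h -> measurable_fun [set: T] (fun w => (h (X w))%:E).
Proof.
by move=> mh; apply/measurable_EFinP; exact: measurableT_comp mh (measurable_funPT X).
Qed.

Lemma mmt_gen_funE (l : R) : mmt_gen_fun P X l = \int[P]_w (expR (l * X w))%:E.
Proof. by rewrite /mmt_gen_fun unlock; apply: eq_integral => w _ /=; rewrite mulrC. Qed.

Lemma moment_le_of_Gnorm (psi : R -> R) (a p : R) :
  (1 <= p)%R -> (0 < psi p)%R -> Gnorm psi X <= a%:E ->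
  \int[P]_w (`|X w| `^ p)%:E <= ((a * psi p) `^ p)%:E.
Proof.
move=> p1 psi0 Ga; have p0 : (0 < p)%R by rewrite (lt_le_trans ltr01).
have : 'N[P]_p%:E[EFin \o X] / (psi p)%:E <= a%:E.
  by apply: le_trans Ga; apply: ereal_sup_ubound; exists p.
rewrite inver gt_eqF// lee_pdivrMr// -EFinM => Na.
have := @poweR_Lnorm _ _ _ P (EFin \o X) p; rewrite gt_eqF// => /(_ isT) E.
rewrite (_ : \int[P]_w _ = 'N[P]_p%:E[EFin \o X] `^ p) ?E// -poweR_EFin -E.
by apply: gt0_ler_poweR; rewrite ?in_itv/= ?leey ?andbT ?Lnorm_ge0 ?(ltW p0)//
  (le_trans _ Na)// Lnorm_ge0.
Qed.

Lemma Lnorm_le_of_moment (b p : R) : (0 < p)%R -> (0 <= b)%R ->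
  \int[P]_w (`|X w| `^ p)%:E <= (b `^ p)%:E -> 'N[P]_p%:E[EFin \o X] <= b%:E.
Proof.
move=> p0 b0 Ib.
have I0 : 0 <= \int[P]_w (`|X w| `^ p)%:E.
  by apply: integral_ge0 => w _; rewrite lee_fin powR_ge0.
have p0' : p != 0%R by rewrite gt_eqF.
rewrite -[b]powRr1// -(mulfV p0') powRrM -poweR_EFin unlock.
by apply: gt0_ler_poweR; rewrite ?in_itv/= ?leey ?andbT ?invr_ge0 ?(ltW p0)//
  lee_fin powR_ge0.
Qed.

Lemma moment_le_mmt_gen_fun (p l : R) : (0 < p)%R -> (0 < l)%R ->
  \int[P]_w (`|X w| `^ p)%:E <=
  ((p / l) `^ p)%:E * (mmt_gen_fun P X l + mmt_gen_fun P X (- l)).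
Proof.
move=> p0 l0; rewrite !mmt_gen_funE.
have mE c : measurable_fun [set: T] (fun w => (expR (c * X w))%:E).
  apply: (@measurable_fun_comp_RV (fun x => expR (c * x))).
  by apply: measurableT_comp => //; exact: mulrl_measurable.
rewrite -ge0_integralD//=.
rewrite -ge0_integralZl//=; last 3 first.
- by apply: emeasurable_funD; exact: mE.
- by move=> w _; rewrite adde_ge0// lee_fin expR_ge0.
- by rewrite lee_fin powR_ge0.
apply: ge0_le_integral => //.
- apply: (@measurable_fun_comp_RV (fun x => `|x| `^ p)%R).
  exact: (measurableT_comp (measurable_powR p) (@normr_measurable R setT)).
- by apply: emeasurable_funM => //; apply: emeasurable_funD; exact: mE.
- by move=> w _; rewrite -EFinD -EFinM lee_fin powR_norm_le_expR.
Qed.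

(** Integrates [expR_le_cosh]: the linear term has mean zero, and the even remainder is bounded by
    [cosh_le_series] and integrated termwise. *)
Lemma mmt_gen_fun_le_even_moments (l : R) : centered X ->
  mmt_gen_fun P X l <= 1 + 2%:E *
    \sum_(2 <= k <oo | ~~ odd k) \int[P]_w ((l * X w) ^+ k / k`!%:R)%:E.
Proof.
move=> [iX EX]; set S := \sum_(2 <= k <oo | _) _.
pose t k w := ((l * X w) ^+ k / k`!%:R)%:E.
have t0 k w : ~~ odd k -> 0 <= t k w.
  by move=> ek; rewrite lee_fin divr_ge0// exprn_even_ge0.
have mt k : measurable_fun [set: T] (t k).
  apply: (@measurable_fun_comp_RV (fun x => (l * x) ^+ k / k`!%:R)%R).
  apply: measurable_funM => //; apply: measurable_funX.
  exact: mulrl_measurable.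
have S0 : 0 <= S by apply: nneseries_ge0 => k _ ek; apply: integral_ge0 => w _; exact: t0.
(* An infinite sum makes the bound trivial; a finite one supplies the integrability needed to split
   the integral of the majorant. *)
have [->|Sfin] := eqVneq S +oo; first by rewrite gt0_muley ?lte_fin// addey ?leey.
pose h w := (expR (l * X w) + expR (- (l * X w)) - 2)%R.
have h0 w : (0 <= h w)%R.
  by have := expR_ge1Dx (l * X w); have := expR_ge1Dx (- (l * X w)); rewrite /h; lra.
have mh : measurable_fun [set: T] (EFin \o h).
  apply: (@measurable_fun_comp_RV (fun x => expR (l * x) + expR (- (l * x)) - 2)%R).
  apply: measurable_funB => //; apply: measurable_funD.
    by apply: measurableT_comp => //; exact: mulrl_measurable.
  apply: measurableT_comp => //; apply: measurableT_comp => //; exact: mulrl_measurable.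
have mtS : measurable_fun [set: T] (fun w => \sum_(2 <= k <oo | ~~ odd k) t k w).
  exact: measurable_fun_nneseries.
have Ih : \int[P]_w (h w)%:E <= 2%:E * S.
  rewrite /S -integral_nneseries_cond// -ge0_integralZl//; last first.
    by move=> w _; apply: nneseries_ge0 => k _; exact: t0.
  apply: ge0_le_integral => //.
  - by move=> w _; rewrite lee_fin.
  - by apply: emeasurable_funM.
  - by move=> w _; exact: cosh_le_series.
have ih : P.-integrable setT (EFin \o h).
  apply/integrableP; split => //.
  under eq_integral do rewrite /= ger0_norm//.
  by rewrite (le_lt_trans Ih)// ltey_eq fin_numM// ge0_fin_numE// ltey.
have i1 : P.-integrable setT (EFin \o cst 1%R) by exact: finite_measure_integrable_cst.
have ilX : P.-integrable setT (fun w => l%:E * (X w)%:E) by exact: integrableZl.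
have i1lX : P.-integrable setT (fun w => (EFin \o cst 1%R) w + l%:E * (X w)%:E).
  exact: integrableD.
have irhs : P.-integrable setT
    (fun w => ((EFin \o cst 1%R) w + l%:E * (X w)%:E) + (EFin \o h) w).
  exact: integrableD.
have mE : measurable_fun [set: T] (fun w => (expR (l * X w))%:E).
  apply: (@measurable_fun_comp_RV (fun x => expR (l * x))).
  by apply: measurableT_comp => //; exact: mulrl_measurable.
have le_w w : (expR (l * X w))%:E <=
    ((EFin \o cst 1%R) w + l%:E * (X w)%:E) + (EFin \o h) w.
  by rewrite /= -EFinM -!EFinD lee_fin expR_le_cosh.
have iE : P.-integrable setT (fun w => (expR (l * X w))%:E).
  apply: le_integrable irhs => // w _.
  have E0 : 0 <= (expR (l * X w))%:E by rewrite lee_fin expR_ge0.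
  by rewrite (gee0_abs E0) gee0_abs// (le_trans E0 (le_w w)).
rewrite mmt_gen_funE.
apply: (@le_trans _ _ (\int[P]_w
    (((EFin \o cst 1%R) w + l%:E * (X w)%:E) + (EFin \o h) w))).
  by apply: le_integral => // w _; exact: le_w.
have I1 : \int[P]_w (EFin \o cst 1%R) w = 1.
  rewrite (integral_cst P measurableT 1) mul1e; exact: probability_setT.
rewrite integralD// integralD// integralZl// I1.
by move: EX; rewrite unlock => ->; rewrite mule0 adde0 leeD2l.
Qed.

End moments.

(** * From [Gnorm] to [Bnorm] *)

Lemma psi_phi_gt0 (R : realType) (phi : R -> R) (p : R) : 0 < p -> 0 < psi_phi phi p.
Proof. by move=> p0; rewrite mulr_gt0// expR_gt0. Qed.

(** The left side is a single term of the exponential series at [k]. *)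
Lemma exprnn_le_fact_expR (R : realType) (k : nat) :
  (0 < k)%N -> k%:R ^+ k / k`!%:R <= expR k%:R :> R.
Proof.
case: k => // k _; apply: le_trans (@expR_ge1Dxn R k.+1%:R k (ler0n _ _)).
by rewrite lerDr.
Qed.

Lemma even_moments_le (R : realType) (phi : R -> R) d (T : measurableType d)
    (P : probability T R) (X : {RV P >-> R}) (a l : R) :
  0 < a -> (Gnorm (psi_phi phi) X <= a%:E)%E ->
  (\sum_(2 <= k <oo | ~~ odd k) \int[P]_w ((l * X w) ^+ k / k`!%:R)%:E <=
   even_series (Delta_phi phi) (expR 1 * a * `|l|))%E.
Proof.
move=> a0 Ga; rewrite /even_series eseries_cond [leRHS]eseries_cond.
apply: lee_nneseries => [k _ /andP[ek _]|k /andP[ek k2]].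
  apply: integral_ge0 => w _.
  by rewrite lee_fin divr_ge0// exprn_even_ge0.
have k0 : (0 < k)%N by rewrite (ltn_trans _ k2).
have kR0 : 0 < k%:R :> R by rewrite ltr0n.
have kR1 : 1 <= k%:R :> R by rewrite ler1n.
have E w : (l * X w) ^+ k / k`!%:R = `|l| ^+ k / k`!%:R * (`|X w| `^ k%:R).
  by rewrite powR_mulrn// mulrAC -exprMn -normrM -normrX ger0_norm// exprn_even_ge0.
under eq_integral do rewrite E EFinM.
have c0 : 0 <= `|l| ^+ k / k`!%:R by rewrite divr_ge0// exprn_ge0.
rewrite ge0_integralZl_EFin//; last first.
  apply: (@measurable_fun_comp_RV _ _ _ _ _ (fun x => `|x| `^ k%:R)).
  exact: (measurableT_comp (measurable_powR _) (@normr_measurable R setT)).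
have := moment_le_of_Gnorm kR1 (psi_phi_gt0 phi kR0) Ga.
move=> M; apply: (@le_trans _ _ ((`|l| ^+ k / k`!%:R)%:E * ((a * psi_phi phi k%:R) `^ k%:R)%:E)%E).
  by rewrite lee_wpmul2l ?lee_fin.
rewrite -EFinM lee_fin powR_mulrn; last by rewrite mulr_ge0 ?(ltW a0)// ltW// psi_phi_gt0.
(* The [k]-th power of [psi_phi phi k] is [k ^+ k * expR (- Delta_phi phi k)]. Its first factor
   meets the factorial, and the resulting bound [expR k] is the source of [expR 1] in the argument
   of the series. *)
rewrite /psi_phi !exprMn -!expRM_natl mulr1 mulrN.
rewrite (mulrC _ (_ / _)) divfK ?gt_eqF//.
rewrite (_ : _ * _ = k%:R ^+ k / k`!%:R * (a ^+ k * (`|l| ^+ k * expR (- Delta_phi phi k%:R))));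
  last by ring.
rewrite -2![leRHS]mulrA ler_wpM2r//; last exact: exprnn_le_fact_expR.
by rewrite !mulr_ge0 ?expR_ge0 ?exprn_ge0// ltW.
Qed.

(** A real [a > 0] replaces the norm itself because only positive [tau] are admissible, while
    [Gnorm] may vanish. [K] precedes the probability space, so it depends on [phi] alone. *)
Lemma Bnorm_le_of_Gnorm (R : realType) (phi : R -> R) :
  Phi phi -> cond_Delta (Delta_phi phi) -> exists2 K : R, 0 < K &
  forall d (T : measurableType d) (P : probability T R) (X : {RV P >-> R}) (a : R),
    centered X -> 0 < a -> (Gnorm (psi_phi phi) X <= a%:E)%E ->
    (Bnorm phi X <= (K * a)%:E)%E.
Proof.
move=> hphi hD; have [K K0 hK] := even_series_expR_phi hphi hD.
exists (K * expR 1); first by rewrite mulr_gt0 ?expR_gt0.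
move=> d T P X a cX a0 Ga; apply: ereal_inf_lbound.
exists (K * expR 1 * a) => //=; split; first by rewrite !mulr_gt0 ?expR_gt0.
suff mgf l : (mmt_gen_fun P X l <= (expR (phi (l * (K * expR 1 * a))))%:E)%E.
  move=> l; rewrite ge_max mgf/=; have := mgf (- l).
  by rewrite mulNr (Phi_even hphi).
(* The series bound [hK] covers positive arguments only, so [l = 0] is computed directly. *)
have [->|l0] := eqVneq l 0.
  rewrite mul0r (Phi_0 hphi) expR0 mmt_gen_funE.
  under eq_integral do rewrite mul0r expR0.
  rewrite (integral_cst P measurableT 1) mul1e.
  by have /= := probability_setT P => ->.
apply: le_trans (mmt_gen_fun_le_even_moments l cX) _.
have x0 : 0 < expR 1 * a * `|l| by rewrite !mulr_gt0 ?expR_gt0 ?normr_gt0.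
rewrite -(Phi_abs hphi) normrM (gtr0_norm (_ : 0 < K * expR 1 * a)); last first.
  by rewrite !mulr_gt0 ?expR_gt0.
rewrite (_ : `|l| * _ = K * (expR 1 * a * `|l|)); last by ring.
apply: le_trans (hK _ x0).
by rewrite leeD2l// lee_pmul2l// even_moments_le.
Qed.

(** * From [Bnorm] to [Gnorm] *)

Lemma Delta_phi_adherent (R : realType) (phi : R -> R) (p e : R) :
  Phi phi -> 0 < p -> 0 < e -> exists y, Delta_phi phi p - e < p * y - beta phi y.
Proof.
move=> hphi p0 e0; have Df := fenchel_beta_fin_num hphi p0.
have [_ [y _ <-]] := ub_ereal_sup_adherent e0 Df.
by rewrite -/(fenchel _ _ _) -(fineK Df) -EFinB lte_fin; exists y.
Qed.

Lemma Gnorm_le_of_mgf (R : realType) (phi : R -> R) d (T : measurableType d)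
    (P : probability T R) (X : {RV P >-> R}) (tau : R) : Phi phi -> 0 < tau ->
  (forall l, (mmt_gen_fun P X l <= (expR (phi (l * tau)))%:E)%E) ->
  (Gnorm (psi_phi phi) X <= (2 * expR 1 * tau)%:E)%E.
Proof.
move=> hphi t0 mgf; apply: ge_ereal_sup => _ [p /= p1 <-].
have p0 : 0 < p by rewrite (lt_le_trans ltr01).
have psi0 := psi_phi_gt0 phi p0.
rewrite inver gt_eqF// lee_pdivrMr// -EFinM.
have b0 : 0 <= 2 * expR 1 * tau * psi_phi phi p.
  apply: mulr_ge0; last exact: ltW.
  by rewrite !mulr_ge0 ?expR_ge0 ?(ltW t0).
apply: Lnorm_le_of_moment => //.
(* A maximizer up to an error of [1] suffices. With [l = expR y / tau], the exponent [phi (l * tau)]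
   is exactly [beta phi y]. *)
have [y hy] := Delta_phi_adherent hphi p0 ltr01.
have l0 : 0 < expR y / tau by rewrite divr_gt0 ?expR_gt0.
apply: le_trans (moment_le_mmt_gen_fun X p0 l0) _.
have mgf1 := mgf (expR y / tau); have := mgf (- (expR y / tau)).
rewrite mulNr (Phi_even hphi) divfK ?gt_eqF// => mgf2.
rewrite divfK ?gt_eqF// in mgf1.
apply: (@le_trans _ _ (((p / (expR y / tau)) `^ p)%:E *
    (expR (beta phi y) + expR (beta phi y))%:E)%E).
  by rewrite lee_wpmul2l ?lee_fin ?powR_ge0// EFinD leeD.
rewrite -EFinM lee_fin invf_div mulrA -expRN.
rewrite (_ : 2 * _ * _ * _ = p * tau * (2 * expR (1 - Delta_phi phi p / p))); last first.
  by rewrite /psi_phi expRD; ring.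
have pt0 : 0 <= p * tau by rewrite mulr_ge0 ?ltW.
move: (p * tau) pt0 => q q0; rewrite !powRM ?mulr_ge0 ?expR_ge0//.
rewrite -!expRM -mulrA ler_wpM2l ?powR_ge0//.
rewrite (_ : (1 - _ / p) * p = p - Delta_phi phi p); last by field; rewrite gt_eqF.
(* [p >= 1] enters twice, through [2 <= 2 ^ p] and by absorbing the error [1] into [p]; hence the
   constant [2 * expR 1] is uniform in [p]. *)
have two_le : 2 <= 2 `^ p :> R.
  by rewrite -{1}[2]powRr1// ler_powR// ler1n.
apply: (@le_trans _ _ (2 * expR (p - Delta_phi phi p))); last first.
  by rewrite ler_wpM2r ?expR_ge0.
rewrite -[_ + expR _]mulr2n -[_ *+ 2]mulr_natl mulrCA ler_wpM2l// -expRD ler_expR.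
by rewrite mulNr mulrC; lra.
Qed.

(** Each admissible [tau] gives a bound by [Gnorm_le_of_mgf]; moving the positive constant inside
    the infimum joins these bounds, even when no [tau] is admissible. *)
Lemma Gnorm_le_Bnorm (R : realType) (phi : R -> R) d (T : measurableType d)
    (P : probability T R) (X : {RV P >-> R}) : Phi phi ->
  (Gnorm (psi_phi phi) X <= (2 * expR 1)%:E * Bnorm phi X)%E.
Proof.
move=> hphi; have c0 : 0 < 2 * expR 1 :> R by rewrite mulr_gt0 ?expR_gt0.
rewrite -ereal_inf_pZl//; apply/ereal_infP => _ [_ [tau [t0 mgf] <-] <-].
rewrite -EFinM; apply: Gnorm_le_of_mgf => // l.
by have := mgf l; rewrite ge_max => /andP[].
Qed.

Lemma Gnorm_ge0 (R : realType) (psi : R -> R) d (T : measurableType d)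
    (P : probability T R) (X : {RV P >-> R}) :
  (forall p, 1 <= p -> 0 < psi p) -> (0 <= Gnorm psi X)%E.
Proof.
move=> psi0; apply: (@le_trans _ _ ('N[P]_1%:E[EFin \o X] / (psi 1)%:E)%E).
  by rewrite inver gt_eqF ?psi0// mule_ge0 ?Lnorm_ge0// lee_fin invr_ge0 ltW ?psi0.
by apply: ereal_sup_ubound; exists 1 => /=.
Qed.

Unset Implicit Arguments.

Theorem theorem4p3 (R : realType) (phi : R -> R) (hphi : Phi phi)
    (hDelta : cond_Delta (Delta_phi phi)) :
  exists C C' : R, [/\ 0 < C, 0 < C' &
    forall (d : measure_display) (T : measurableType d) (P : probability T R)
           (X : {RV P >-> R}), centered X ->
      (Bnorm phi X <= C%:E * Gnorm (psi_phi phi) X)%E /\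
      (C%:E * Gnorm (psi_phi phi) X <= C'%:E * Bnorm phi X)%E].
Proof.
have [K K0 hK] := Bnorm_le_of_Gnorm hphi hDelta.
have c0 : 0 < 2 * expR 1 :> R by rewrite mulr_gt0 ?expR_gt0.
exists K, (K * (2 * expR 1)); split => //; first by rewrite mulr_gt0.
move=> d T P X cX; split; last first.
  by rewrite EFinM -muleA lee_pmul2l// Gnorm_le_Bnorm.
have G0 : (0 <= Gnorm (psi_phi phi) X)%E.
  by apply: Gnorm_ge0 => p p1; rewrite psi_phi_gt0 ?(lt_le_trans ltr01).
have [->|Gy] := eqVneq (Gnorm (psi_phi phi) X) +oo%E.
  by rewrite gt0_muley ?lte_fin// leey.
have Gf : Gnorm (psi_phi phi) X \is a fin_num by rewrite ge0_fin_numE// ltey.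
(* The slack [e / K] keeps the argument of [hK] positive when [Gnorm] is zero, and multiplication by
   [K] turns it into [e]. *)
rewrite -(fineK Gf) -EFinM; apply/lee_addgt0Pr => e e0.
have g0 : 0 <= fine (Gnorm (psi_phi phi) X) by rewrite fine_ge0.
have eK0 : 0 < e / K by rewrite divr_gt0.
have := hK _ _ _ _ (fine (Gnorm (psi_phi phi) X) + e / K) cX.
rewrite mulrDr mulrCA divff ?gt_eqF// mulr1 EFinD; apply.
  by rewrite ltr_wpDl.
by rewrite fineK// leeDl// lee_fin ltW.
Qed.
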